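(* Let $\beta$ be a constant, $\hat\beta=\beta+1$, and $x=e^{-t}$. Let $f$ and $\hat f$ be differentiable functions of $t$ related by $$(f+\beta)(\hat f-\hat\beta)=x^2 .$$ Then this relation establishes the equivalence of two Riccati equations: $$f_t+f^2=\beta^2+x^2\quad\Longleftrightarrow\quad \hat f_t+\hat f^2=\hat\beta^2+x^2 .$$
   Context: Functions are complex-valued functions of a real variable $t$ on an open interval, subscript $t$ denotes $\frac{d}{dt}$, and $x=e^{-t}$, so that $\frac{d}{dt}(x^2)=-2x^2$. Each Riccati equation is understood to hold at every point of the interval. *)

(* Defs.v *)
From Stdlib Require Import Reals.
From Coquelicot Require Import Coquelicot.

Open Scope C_scope.

Definition xvar (t : R) : C := RtoC (exp (- t)).

(* The endpoints of the open interval (a, b) may be infinite. *)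
Definition in_open_interval (a b : Rbar) (t : R) : Prop :=
  Rbar_lt a (Finite t) /\ Rbar_lt (Finite t) b.

(* f : R -> C has derivative l at the real point t.  The codomain is C as a
   normed space over R, so that no complex differentiability is involved. *)
Definition is_derive_RC (f : R -> C) (t : R) (l : C) : Prop :=
  @is_derive R_AbsRing C_R_NormedModule f t l.

(* Main.v *)
Require Import Defs.
From Stdlib Require Import Reals.
From Coquelicot Require Import Coquelicot.

(** Put [F = f + beta], [G = fhat - betahat], so that [F * G = x ^ 2], and let
    [E], [Ehat] be the left side minus the right side of the two Riccati
    equations.  Writing [x ^ 2] as [F * G] in both, and using
    [betahat = beta + 1],
<<
      E    = F_t + F ^ 2 - 2 * beta * F    - F * G
      Ehat = G_t + G ^ 2 + 2 * betahat * G - F * G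
      G * E + F * Ehat = (F * G)_t + 2 * (betahat - beta) * F * G
                       = (x ^ 2)_t + 2 * x ^ 2 = 0.
>>
    The product [F * G = x ^ 2] never vanishes, hence neither does [F] or [G],
    and [E = 0] if and only if [Ehat = 0], at each point separately.  The
    algebra is [defects_cancel]; the analytic input is the derivative of the
    product relation, [relation_derivative], which rests on the product rule
    and the uniqueness of the derivative for complex-valued functions of a
    real variable. *)

Open Scope C_scope.

(** Taking real and imaginary parts is linear over the reals, and so is
    reassembling them; the rules for products and the uniqueness of the
    derivative are reduced in this way to their real versions. *)
Lemma is_derive_RC_parts (f : R -> C) (t : R) (l : C) :
  is_derive_RC f t l <->
  is_derive (fun s => Re (f s)) t (Re l) /\
  is_derive (fun s => Im (f s)) t (Im l).
Proof.
  unfold is_derive_RC, is_derive; split.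
  - intros Hf; split.
    + exact (filterdiff_comp' (V := C_R_NormedModule) (W := R_NormedModule)
               f fst t _ fst Hf (filterdiff_linear _ is_linear_fst)).
    + exact (filterdiff_comp' (V := C_R_NormedModule) (W := R_NormedModule)
               f snd t _ snd Hf (filterdiff_linear _ is_linear_snd)).
  - intros [Hre Him].
    (* The pairing map that reassembles [f] from its parts is the identity of
       [R * R], which is linear. *)
    apply (filterdiff_ext (U := R_NormedModule) (V := C_R_NormedModule)
             (fun s => (Re (f s), Im (f s)))).
    { intros s; symmetry; apply surjective_pairing. }
    apply (filterdiff_comp'_2 (W := C_R_NormedModule) _ _ pair t _ _ pair
             Hre Him).
    apply (filterdiff_ext (V := C_R_NormedModule) (fun p => p)).
    { intros p; apply surjective_pairing. }
    apply (filterdiff_ext_lin (V := C_R_NormedModule) _ (fun p => p)).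
    + apply filterdiff_id.
    + intros p; apply surjective_pairing.
Qed.

Lemma is_derive_RC_unique (f : R -> C) (t : R) (l1 l2 : C) :
  is_derive_RC f t l1 -> is_derive_RC f t l2 -> l1 = l2.
Proof.
  intros H1 H2.
  apply is_derive_RC_parts in H1; destruct H1 as [Hre1 Him1].
  apply is_derive_RC_parts in H2; destruct H2 as [Hre2 Him2].
  apply is_derive_unique in Hre1, Him1, Hre2, Him2.
  apply injective_projections; unfold Re, Im in *; congruence.
Qed.

Lemma is_derive_RC_plus_const (f : R -> C) (t : R) (l c : C) :
  is_derive_RC f t l -> is_derive_RC (fun s => f s + c) t l.
Proof.
  intros Hf.
  apply is_derive_RC_parts in Hf; destruct Hf as [Hre Him].
  apply is_derive_RC_parts; split; simpl.
  - rewrite <- (Rplus_0_r (Re l)).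
    exact (is_derive_plus _ _ t _ _ Hre (is_derive_const _ t)).
  - rewrite <- (Rplus_0_r (Im l)).
    exact (is_derive_plus _ _ t _ _ Him (is_derive_const _ t)).
Qed.

(** The product rule over the reals applies to each of the four products of
    real and imaginary parts. *)
Lemma is_derive_RC_mult (f g : R -> C) (t : R) (f' g' : C) :
  is_derive_RC f t f' -> is_derive_RC g t g' ->
  is_derive_RC (fun s => f s * g s) t (f' * g t + f t * g').
Proof.
  intros Hf Hg.
  apply is_derive_RC_parts in Hf; destruct Hf as [Hfre Hfim].
  apply is_derive_RC_parts in Hg; destruct Hg as [Hgre Hgim].
  assert (mul : forall u v u' v', is_derive u t u' -> is_derive v t v' ->
            is_derive (fun s => (u s * v s)%R) t (u' * v t + u t * v')%R).
  { intros u v u' v' Hu Hv; exact (is_derive_mult u v t u' v' Hu Hv Rmult_comm). }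
  apply is_derive_RC_parts; split; simpl.
  - match goal with |- is_derive _ _ ?d => replace d with
      ((Re f' * Re (g t) + Re (f t) * Re g')
       - (Im f' * Im (g t) + Im (f t) * Im g'))%R
      by (unfold Re, Im; ring) end.
    exact (is_derive_minus _ _ t _ _ (mul _ _ _ _ Hfre Hgre)
             (mul _ _ _ _ Hfim Hgim)).
  - match goal with |- is_derive _ _ ?d => replace d with
      ((Re f' * Im (g t) + Re (f t) * Im g')
       + (Im f' * Re (g t) + Im (f t) * Re g'))%R
      by (unfold Re, Im; ring) end.
    exact (is_derive_plus _ _ t _ _ (mul _ _ _ _ Hfre Hgim)
             (mul _ _ _ _ Hfim Hgre)).
Qed.

Lemma is_derive_RC_ext_loc (f g : R -> C) (t : R) (l : C) :
  locally t (fun s => f s = g s) -> is_derive_RC f t l -> is_derive_RC g t l.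
Proof. exact (is_derive_ext_loc (V := C_R_NormedModule) f g t l). Qed.

Lemma xvar_neq_0 (t : R) : xvar t <> 0.
Proof.
  intros H; apply RtoC_inj in H.
  exact (Rgt_not_eq _ _ (exp_pos (- t)) H).
Qed.

Lemma is_derive_xvar (t : R) : is_derive_RC xvar t (- xvar t).
Proof.
  apply is_derive_RC_parts; split; simpl.
  - auto_derive; [exact I | ring].
  - rewrite Ropp_0; exact (is_derive_const 0%R t).
Qed.

Lemma is_derive_xvar_sqr (t : R) :
  is_derive_RC (fun s => xvar s ^ 2) t (- (2 * xvar t ^ 2)).
Proof.
  replace (- (2 * xvar t ^ 2)) with (- xvar t * xvar t + xvar t * - xvar t)
    by ring.
  apply is_derive_RC_ext_loc with (fun s => xvar s * xvar s).
  { apply filter_forall; intros s; ring. }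
  apply is_derive_RC_mult; apply is_derive_xvar.
Qed.

Lemma locally_in_open_interval (a b : Rbar) (t : R) :
  in_open_interval a b t -> locally t (in_open_interval a b).
Proof.
  intros [Ha Hb]; apply filter_and.
  - exact (open_Rbar_gt a t Ha).
  - exact (open_Rbar_lt b t Hb).
Qed.

(** An identity between functions may be differentiated at [t] because it
    holds on a neighbourhood of [t]. *)
Lemma relation_derivative (F G : R -> C) (t : R) (F' G' : C) :
  is_derive_RC F t F' -> is_derive_RC G t G' ->
  locally t (fun s => F s * G s = xvar s ^ 2) ->
  F' * G t + F t * G' = - (2 * xvar t ^ 2).
Proof.
  intros HF HG Hrel.
  apply (is_derive_RC_unique (fun s => xvar s ^ 2) t).
  - apply is_derive_RC_ext_loc with (fun s => F s * G s); [exact Hrel |].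
    now apply is_derive_RC_mult.
  - apply is_derive_xvar_sqr.
Qed.

(** With [p = f + beta] and [q = fhat - betahat], the terms cubic in [p], [q]
    cancel between the two defects, and [betahat - beta = 1] is exactly what
    balances the logarithmic derivative [-2] of [x ^ 2]. *)
Lemma defects_cancel (beta u v u' v' y : C) :
  (u + beta) * (v - (beta + 1)) = y ->
  u' * (v - (beta + 1)) + (u + beta) * v' = - (2 * y) ->
  (v - (beta + 1)) * (u' + u ^ 2 - (beta ^ 2 + y))
  + (u + beta) * (v' + v ^ 2 - ((beta + 1) ^ 2 + y)) = 0.
Proof.
  intros <- Hder.
  transitivity
    (u' * (v - (beta + 1)) + (u + beta) * v'
     + 2 * ((u + beta) * (v - (beta + 1)))); [ring |].
  rewrite Hder; ring.
Qed.

Lemma Cmult_eq_0_reg_l (p z : C) : p <> 0 -> p * z = 0 -> z = 0.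
Proof.
  intros Hp H.
  replace z with (/ p * (p * z)) by (field; exact Hp).
  rewrite H; ring.
Qed.

Lemma Cminus_eq_0_iff (z w : C) : z - w = 0 <-> z = w.
Proof.
  split; intros H.
  - replace z with (z - w + w) by ring; rewrite H; ring.
  - rewrite H; ring.
Qed.

Lemma vanish_together (p q z w : C) :
  p <> 0 -> q <> 0 -> q * z + p * w = 0 -> (z = 0 <-> w = 0).
Proof.
  intros Hp Hq H; split; intros ->.
  - apply (Cmult_eq_0_reg_l p); [exact Hp |]; rewrite <- H; ring.
  - apply (Cmult_eq_0_reg_l q); [exact Hq |]; rewrite <- H; ring.
Qed.

Theorem theorem2 (a b : Rbar) (beta betahat : C) (f f_t fhat fhat_t : R -> C)
  (Hbetahat : betahat = beta + 1)
  (Hf : forall t : R, in_open_interval a b t -> is_derive_RC f t (f_t t))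
  (Hfhat : forall t : R, in_open_interval a b t ->
     is_derive_RC fhat t (fhat_t t))
  (Hrel : forall t : R, in_open_interval a b t ->
     (f t + beta) * (fhat t - betahat) = xvar t ^ 2) :
  (forall t : R, in_open_interval a b t ->
     f_t t + f t ^ 2 = beta ^ 2 + xvar t ^ 2)
  <->
  (forall t : R, in_open_interval a b t ->
     fhat_t t + fhat t ^ 2 = betahat ^ 2 + xvar t ^ 2).
Proof.
  subst betahat.
  assert (pointwise : forall t, in_open_interval a b t ->
    (f_t t + f t ^ 2 = beta ^ 2 + xvar t ^ 2 <->
     fhat_t t + fhat t ^ 2 = (beta + 1) ^ 2 + xvar t ^ 2)).
  { intros t Ht.
    assert (Hder : f_t t * (fhat t - (beta + 1)) + (f t + beta) * fhat_t t
                   = - (2 * xvar t ^ 2)).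
    { apply (relation_derivative (fun s => f s + beta)
               (fun s => fhat s - (beta + 1))).
      - now apply is_derive_RC_plus_const, Hf.
      - now apply is_derive_RC_plus_const, Hfhat.
      - exact (filter_imp _ _ Hrel (locally_in_open_interval a b t Ht)). }
    assert (Hx : xvar t ^ 2 <> 0).
    { simpl; rewrite Cmult_1_r.
      apply Cmult_neq_0; apply xvar_neq_0. }
    rewrite <- (Cminus_eq_0_iff (f_t t + _)), <- (Cminus_eq_0_iff (fhat_t t + _)).
    apply (vanish_together (f t + beta) (fhat t - (beta + 1))).
    - intros H0; apply Hx; rewrite <- (Hrel t Ht), H0; ring.
    - intros H0; apply Hx; rewrite <- (Hrel t Ht), H0; ring.
    - exact (defects_cancel _ _ _ _ _ _ (Hrel t Ht) Hder). }
  split; intros H t Ht; now apply (pointwise t Ht), H.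
Qed.
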